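(* Let $E$, $S$, $D$ be the encoder, solver and decoder maps defined in the context, and let $V=\operatorname{span}\{\varphi_j\}_{j=0}^J\subset H$. Then the mapping $$P:H\to V\subset H,\qquad P = D\circ S\circ E,$$ is a well-defined projection map, i.e. $P^2=P$.
   Context: Let $H$ be a Hilbert function space on a set $X$ (a real Hilbert space of functions on $X$) and $\{\varphi_j\}_{j=0}^J$ a finite collection of functions in $H$. Let $\mathcal{H}$ be a Hilbert function space on $[a,b]$ and $\{\psi_k\}_{k=0}^K$ a finite subset of basis functions in $\mathcal{H}$. Suppose $x:[a,b]\to X$ defines a bounded composition operator $C_x:H\to\mathcal{H}$, $C_x(g)=g\circ x$. Let $\bm{G}\in\mathbb{R}^{(K+1)\times(J+1)}$ have entries $\bm{G}_{k,j}=\langle \varphi_j\circ x,\psi_k\rangle_{\mathcal{H}}$ and let $\lambda\geq 0$. Define $$E:H\to\mathbb{R}^{K+1},\quad E(g)=\left[\langle g\circ x,\psi_0\rangle_{\mathcal{H}},\dots,\langle g\circ x,\psi_K\rangle_{\mathcal{H}}\right]^\top,$$ $$S:\mathbb{R}^{K+1}\to\mathbb{R}^{J+1},\quad S(\bm{b})=\operatorname*{argmin}_{\bm{w}\in\mathbb{R}^{J+1}}\|\bm{G}\bm{w}-\bm{b}\|+\lambda\|\bm{w}\|,$$ $$D:\mathbb{R}^{J+1}\to H,\quad D(\bm{w})=\sum_{j=0}^J w_j\varphi_j .$$ The norms in the definition of $S$ are arbitrary fixed norms on $\mathbb{R}^{K+1}$ and $\mathbb{R}^{J+1}$ respectively.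 Standing assumption: $S$ is well-defined, i.e. the minimization problem defining $S(\bm{b})$ has a unique minimizer for every $\bm{b}\in\mathbb{R}^{K+1}$. *)

(* Defs.v *)
From HB Require Import structures.
From mathcomp Require Import all_boot all_order all_algebra.
From mathcomp Require Import all_classical all_reals all_analysis.

Set Implicit Arguments.
Unset Strict Implicit.
Unset Printing Implicit Defensive.

Import Order.TTheory GRing.Theory Num.Theory.
Import numFieldNormedType.Exports.

Local Open Scope classical_set_scope.
Local Open Scope ring_scope.

(* A real Hilbert space of functions on X: a complete normed module whose norm
   comes from an inner product, identified with a linear subspace of X -> R by
   the injective linear map [hfun].  Boundedness of the point evaluations is
   not required. *)
HB.mixin Record isHilbertFunctionSpace (R : realType) (X : Type) (H : Type)
    of CompleteNormedModule R H := {
  hdot : {dot H for idfun} ;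
  hdot_norm : forall f : H, hdot f f = `|f| ^+ 2 ;
  hfun : {linear H -> (X -> R^o)} ;
  hfun_inj : injective hfun
}.

#[short(type="hilbertFunctionSpaceType")]
HB.structure Definition HilbertFunctionSpace (R : realType) (X : Type) :=
  {H of isHilbertFunctionSpace R X H & CompleteNormedModule R H}.

Record is_norm (R : realType) (n : nat) (N : 'cV[R]_n -> R) : Prop := IsNorm {
  is_norm_eq0 : forall v, N v = 0 -> v = 0 ;
  is_normZ : forall (c : R) v, N (c *: v) = `|c| * N v ;
  is_normD : forall u v, N (u + v) <= N u + N v
}.

Definition argmin (T : Type) (R : realType) (F : T -> R) : set T :=
  [set w | forall w', F w <= F w'].

Definition lspan (R : realType) (V : lmodType R) (n : nat) (v : 'I_n -> V) :
    set V :=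
  [set u | exists c : 'I_n -> R, u = \sum_(j < n) c j *: v j].

Definition is_projection_on (T : Type) (V : set T) (P : T -> T) : Prop :=
  (forall g, V (P g)) /\ P \o P = P.

(* [C] is the operator g |-> g \o x; since [hfun] is injective, at most one [C]
   satisfies this for a given [x]. *)
Definition is_composition_operator (R : realType) (X Y : Type)
    (H : hilbertFunctionSpaceType R X) (HH : hilbertFunctionSpaceType R Y)
    (x : Y -> X) (C : H -> HH) : Prop :=
  forall g : H, hfun (C g) = hfun g \o x :> (Y -> R).

Section EncoderSolverDecoder.
Context (R : realType) (X Y : Type).
Context (H : hilbertFunctionSpaceType R X) (HH : hilbertFunctionSpaceType R Y).
Context (J K : nat) (phi : 'I_J.+1 -> H) (psi : 'I_K.+1 -> HH) (C : H -> HH).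
Context (NK : 'cV[R]_K.+1 -> R) (NJ : 'cV[R]_J.+1 -> R) (lambda : R).

Definition system_mx : 'M[R]_(K.+1, J.+1) :=
  \matrix_(k, j) hdot (C (phi j)) (psi k).

Definition objective (b : 'cV[R]_K.+1) (w : 'cV[R]_J.+1) : R :=
  NK (system_mx *m w - b) + lambda * NJ w.

Definition encoder (g : H) : 'cV[R]_K.+1 := \col_k hdot (C g) (psi k).

(* The default value 0 is used only when [objective b] has no minimizer. *)
Definition solver (b : 'cV[R]_K.+1) : 'cV[R]_J.+1 :=
  xget 0 (argmin (objective b)).

Definition decoder (w : 'cV[R]_J.+1) : H := \sum_(j < J.+1) w j 0 *: phi j.

Definition esd_map : H -> H := decoder \o solver \o encoder.

End EncoderSolverDecoder.

(* Main.v *)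
(* Put w = S b.  Since E (D w) = G w, it suffices that w' = S (G w) equals w.
   Comparing w' with w in the problem for G w gives
   ||G w' - G w|| + lambda ||w'|| <= lambda ||w||; the triangle inequality
   through G w then shows that w' also minimizes the problem for b, so w' = w
   by uniqueness. *)
Require Import Defs.
From HB Require Import structures.
From mathcomp Require Import all_boot all_order all_algebra.
From mathcomp Require Import all_classical all_reals all_analysis.
From mathcomp Require Import lra.

Import Order.TTheory GRing.Theory Num.Theory.
Import numFieldNormedType.Exports.

Local Open Scope classical_set_scope.
Local Open Scope ring_scope.

Set Implicit Arguments.
Unset Strict Implicit.
Unset Printing Implicit Defensive.

Lemma is_norm0 (R : realType) (n : nat) (N : 'cV[R]_n -> R) :
  is_norm N -> N 0 = 0.
Proof. by move=> hN; rewrite -(scale0r 0) is_normZ// normr0 mul0r. Qed.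

Section EncoderSolverDecoder.
Context (R : realType) (X Y : Type).
Context (H : hilbertFunctionSpaceType R X) (HH : hilbertFunctionSpaceType R Y).
Context (J K : nat) (phi : 'I_J.+1 -> H) (psi : 'I_K.+1 -> HH).
Context (C : {linear H -> HH}).
Context (NK : 'cV[R]_K.+1 -> R) (NJ : 'cV[R]_J.+1 -> R) (lambda : R).

Local Notation G := (system_mx phi psi C).
Local Notation F := (objective phi psi C NK NJ lambda).
Local Notation S := (solver phi psi C NK NJ lambda).

(** Both [C] and the inner product in its first argument are linear, so the sum and its coefficients
    come out of the encoder. This turns idempotence of the whole map into a statement about the
    solver alone. *)
Lemma encoder_decoder (w : 'cV[R]_J.+1) :
  encoder psi C (decoder phi w) = G *m w.
Proof.
apply/colP => k; rewrite !mxE linear_sum linear_sumlz.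
by apply: eq_bigr => j _; rewrite !mxE linearZ linearZl_LR mulrC.
Qed.

Lemma lspan_decoder (w : 'cV[R]_J.+1) : lspan phi (decoder phi w).
Proof. by exists (fun j => w j 0). Qed.

Hypothesis hNK : is_norm NK.
Hypothesis hS : forall b, exists! w, argmin (F b) w.

Lemma argmin_solver (b : 'cV[R]_K.+1) : argmin (F b) (S b).
(* A minimizer exists, so [xget] never falls back on its default 0. *)
Proof. by have [w [Fw _]] := hS b; apply: (xgetI _ Fw). Qed.

Lemma argmin_unique (b : 'cV[R]_K.+1) (w : 'cV[R]_J.+1) :
  argmin (F b) w -> w = S b.
Proof.
by have [w0 [_ w0P]] := hS b => /w0P <-; apply: w0P; apply: argmin_solver.
Qed.

(** This is the well-definedness claim: no choice is hidden in [xget]. *)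
Lemma argmin_solverE (b : 'cV[R]_K.+1) : argmin (F b) = [set S b].
Proof.
apply/seteqP; split => w /=; first exact: argmin_unique.
by move=> ->; apply: argmin_solver.
Qed.

Lemma solver_system_mx (b : 'cV[R]_K.+1) : S (G *m S b) = S b.
Proof.
(* Since [S b] is already minimal for [b], it is enough that [w'] does no worse than [S b] there. *)
apply: argmin_unique => v; apply: le_trans (argmin_solver b v).
set w := S b; set w' := S _.
have : F (G *m w) w' <= F (G *m w) w by apply: argmin_solver.
(* For the data [G *m w] the competitor [w] has zero residual, so only its penalty [lambda * NJ w]
   remains on the right. *)
rewrite /objective subrr (is_norm0 hNK) add0r => le_w'w.
have -> : G *m w' - b = (G *m w' - G *m w) + (G *m w - b) by rewrite addrA subrK.
have := is_normD hNK (G *m w' - G *m w) (G *m w - b).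
lra.
Qed.

End EncoderSolverDecoder.

Theorem proposition2p7 (R : realType) (X : Type) (a b : R) (hab : a <= b)
    (H : hilbertFunctionSpaceType R X)
    (HH : hilbertFunctionSpaceType R (set_type [set` `[a, b]]))
    (J K : nat) (phi : 'I_J.+1 -> H) (psi : 'I_K.+1 -> HH)
    (x : set_type [set` `[a, b]] -> X)
    (C : {linear H -> HH})
    (hC : is_composition_operator x C)
    (hCbounded : bounded_near C (nbhs (0 : H)))
    (lambda : R) (hlambda : 0 <= lambda)
    (NK : 'cV[R]_K.+1 -> R) (hNK : is_norm NK)
    (NJ : 'cV[R]_J.+1 -> R) (hNJ : is_norm NJ)
    (hS : forall c : 'cV[R]_K.+1,
      exists! w, argmin (objective phi psi C NK NJ lambda c) w) :
  (forall g : H,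
     argmin (objective phi psi C NK NJ lambda (encoder psi C g)) =
     [set solver phi psi C NK NJ lambda (encoder psi C g)]) /\
  is_projection_on (lspan phi) (esd_map phi psi C NK NJ lambda).
Proof.
split=> [g|]; first exact: argmin_solverE.
split=> [g|]; first exact: lspan_decoder.
(* The inner [encoder \o decoder] becomes multiplication by [G], which the solver then absorbs, with
   [b] the encoding of [g]. *)
by apply/funext => g; rewrite /esd_map /= encoder_decoder solver_system_mx.
Qed.
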